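(* Let $X$ and $Y$ be finite (non-empty) sets in $\mathbb{R}^d$, let $\kappa(x,y)$ be a real-valued function defined on $X\times Y$, let $S\subseteq Y$ be a non-empty subset, and let $K_{XS}$ be decomposed by an interpolative decomposition (computed via strong rank-revealing QR) as $$K_{XS}=UK_{\mathcal{I}S}=P\begin{bmatrix} I\\ G\end{bmatrix}K_{\mathcal{I}S},\qquad \|G\|_{\max}\le 2,$$ with $\mathcal{I}\subseteq X$. Let $m=\operatorname{card}(X)$ and $r=\operatorname{card}(\mathcal{I})$. Then $$\|K_{XY}-UK_{\mathcal{I}Y}\|_{\max}\le L(X\times Y,X\times S)\,\delta_{Y,S}+(1+2r)\sqrt{m}\,L(Y,S)_X\,\delta_{Y,S}+2r\,L(\mathcal{I}\times Y,\mathcal{I}\times S)\,\delta_{Y,S}.$$ Furthermore, if $\kappa$ is Lipschitz continuous with Lipschitz constant $L$ on a set $D_1\times D_2$ containing $X\times Y$, then $$\|K_{XY}-UK_{\mathcal{I}Y}\|_{\max}\le L\,\delta_{Y,S}+(1+2r)\sqrt{m}\,L\,\delta_{Y,S}+2rL\,\delta_{Y,S}.$$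
   Context: For finite sets $A\subseteq X$, $B\subseteq Y$, $K_{AB}$ denotes the matrix with entries $\kappa(a,b)$, rows indexed by $a\in A$ and columns by $b\in B$. $\|M\|_{\max}$ is the maximum absolute value of the entries of $M$, and $|\cdot|$ is the Euclidean norm on $\mathbb{R}^d$ (absolute value for scalars). In the interpolative decomposition, $\mathcal{I}\subseteq X$ is a non-empty subset with $r$ points, $I$ is the $r\times r$ identity matrix, $G$ is an $(m-r)\times r$ real matrix, and $P$ is an $m\times m$ permutation matrix that maps the row indices of $I$ to the indices of the points of $\mathcal{I}$ in $X$ (so the rows of $U=P\begin{bmatrix} I\\ G\end{bmatrix}$ corresponding to $\mathcal{I}$ form the identity matrix). For finite sets $S\subseteq Z$, $S\neq\emptyset$, $\delta_{Z,S}:=\max_{x\in Z}\operatorname{dist}(x,S)$ with $\operatorname{dist}(x,S)=\min_{s\in S}|x-s|$. Discrete Lipschitz constants: for non-empty subsets $\mathcal{Z}=Z_1\times Z_2$, $\mathcal{S}=S_1\times S_2$ of $X\times Y$ and non-empty $W_1\subseteq X$, $$L(\mathcal{Z},\mathcal{S}):=\min\{C\ge 0: |\kappa(x,y)-\kappa(u,v)|^2\le C^2(|x-u|^2+|y-v|^2)\ \ \forall (x,y)\in\mathcal{Z},\,(u,v)\in\mathcal{S}\},$$ $$L(Z_2,S_2)_{W_1}:=\min\{C\ge 0: |\kappa(x,y)-\kappa(x,v)|^2\le C^2|y-v|^2\ \ \forall x\in W_1,\,y\in Z_2,\,v\in S_2\}.$$ Here $D_1,D_2\subseteq\mathbb{R}^d$,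 and Lipschitz continuity of $\kappa$ on $D_1\times D_2$ with constant $L$ means $|\kappa(x,y)-\kappa(u,v)|\le L(|x-u|^2+|y-v|^2)^{1/2}$ for all $(x,y),(u,v)\in D_1\times D_2$. *)

(* Defs.v *)
From HB Require Import structures.
From mathcomp Require Import all_boot all_order all_algebra finmap.
From mathcomp Require Import all_classical all_reals all_analysis.

Set Implicit Arguments.
Unset Strict Implicit.
Unset Printing Implicit Defensive.

Import Order.TTheory GRing.Theory Num.Theory.

Local Open Scope classical_set_scope.
Local Open Scope ring_scope.

(* The canonical norm on ['rV[R]_d] in MathComp-Analysis is the max norm, and
   the norm on a product type is the max of the two norms, so the Euclidean
   norm and the Euclidean Lipschitz condition are spelled out here. *)
Definition enorm (R : realType) (d : nat) (x : 'rV[R]_d) : R :=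
  Num.sqrt (\sum_(i < d) x 0 i ^+ 2).

(* The i-th point of A, in the fixed enumeration carried by the finite set. *)
Definition pt (R : realType) (d : nat) (A : {fset 'rV[R]_d})
  (i : 'I_#|` A|) : 'rV[R]_d := tnth (in_tuple A) i.

(* The matrix K_{AB}.  The kernel is total on R^d x R^d, but only its values on
   A x B are used. *)
Definition kmx (R : realType) (d : nat) (kappa : 'rV[R]_d -> 'rV[R]_d -> R)
    (A B : {fset 'rV[R]_d}) : 'M[R]_(#|` A|, #|` B|) :=
  \matrix_(i, j) kappa (pt i) (pt j).

Section Interpolation.
Variables (R : realType) (d : nat) (X I : {fset 'rV[R]_d}).
Hypothesis hI : (I `<=` X)%fset.

(* The position of the j-th row of the identity block in [1; G]. *)
Definition top_row (j : 'I_#|` I|) : 'I_#|` X| :=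
  widen_ord (fsubset_leq_card hI) j.

(* P is a permutation matrix which sends the unit vector of index [top_row j]
   to the unit vector of index i whenever the i-th point of X is the j-th point
   of I. *)
Definition row_placement (P : 'M[R]_#|` X|) : Prop :=
  is_perm_mx P /\
  forall (i : 'I_#|` X|) (j : 'I_#|` I|), pt i = pt j -> P i (top_row j) = 1.

(* U = P [1; G]; the cast only identifies r + (m - r) with m. *)
Definition interp_mx (P : 'M[R]_#|` X|) (G : 'M[R]_(#|` X| - #|` I|, #|` I|)) :
    'M[R]_(#|` X|, #|` I|) :=
  P *m castmx (subnKC (fsubset_leq_card hI), erefl) (col_mx 1%:M G).

End Interpolation.

Section Distances.
Variables (R : realType) (d : nat).
Implicit Types (x : 'rV[R]_d) (S Z : {fset 'rV[R]_d}).

(* The minimum is started from the distance to one of the points of S, so for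
   S != fset0 it is the minimum over S. *)
Definition dist_to x S : R :=
  \big[Num.min/enorm (x - head 0 (enum_fset S))]_(s <- enum_fset S)
     enorm (x - s).

(* The fill distance delta_{Z,S}. *)
Definition fill_dist Z S : R := \big[Num.max/0]_(x <- enum_fset Z) dist_to x S.

Lemma dist_to_le x S s : s \in S -> dist_to x S <= enorm (x - s).
Proof. by move=> sS; apply: (ge_bigmin_seq _ s xpredT). Qed.

Lemma dist_to_attained x S : S != fset0 ->
  exists2 s, s \in S & dist_to x S = enorm (x - s).
Proof.
move=> S0; rewrite /dist_to big_seq.
apply: (big_ind (fun t => exists2 s, s \in S & t = enorm (x - s))).
- exists (head 0 (enum_fset S)) => //.
  case/fset0Pn: S0 => s; rewrite -[_ \in S]/(_ \in enum_fset S).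
  rewrite -[head _ _ \in S]/(_ \in enum_fset S).
  by case: (enum_fset S) => //= a l _; rewrite mem_head.
- by move=> u v hu hv; rewrite /Num.min; case: ifP.
- by move=> s sS; exists s.
Qed.

Lemma dist_to_ge0 x S : 0 <= dist_to x S.
Proof.
rewrite /dist_to; apply: (big_ind (fun t => 0 <= t)) => [|u v u0 v0|s _];
  rewrite ?sqrtr_ge0//.
by rewrite le_min u0.
Qed.

Lemma le_fill_dist x Z S : x \in Z -> dist_to x S <= fill_dist Z S.
Proof.
by move=> xZ; apply: (le_bigmax_seq _ x xpredT (fun z => dist_to z S)).
Qed.

Lemma fill_dist_attained Z S : Z != fset0 ->
  exists2 x, x \in Z & fill_dist Z S = dist_to x S.
Proof.
case/fset0Pn => z zZ.
have [/eqP d0|d0] := boolP (fill_dist Z S == 0).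
  exists z => //; apply/eqP; rewrite eq_le {1}d0 dist_to_ge0.
  exact: le_fill_dist.
suff [|//] : fill_dist Z S = 0 \/
    exists2 x, x \in Z & fill_dist Z S = dist_to x S.
  by move/eqP; rewrite (negbTE d0).
rewrite /fill_dist big_seq.
apply: (big_ind (fun t => t = 0 \/ exists2 x, x \in Z & t = dist_to x S)).
- by left.
- by move=> u v hu hv; rewrite /Num.max; case: ifP.
- by move=> x xZ; right; exists x.
Qed.

End Distances.

Section Lipschitz.
Variables (R : realType) (d : nat) (kappa : 'rV[R]_d -> 'rV[R]_d -> R).

Definition kernel_lipschitz (D1 D2 : set 'rV[R]_d) (L : R) : Prop :=
  forall x y u v, D1 x -> D2 y -> D1 u -> D2 v ->
    `|kappa x y - kappa u v| <=
      L * Num.sqrt (enorm (x - u) ^+ 2 + enorm (y - v) ^+ 2).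

Definition lip_set (Z S : {fset 'rV[R]_d * 'rV[R]_d}) : set R :=
  [set C | 0 <= C /\ forall x y u v, (x, y) \in Z -> (u, v) \in S ->
    `|kappa x y - kappa u v| ^+ 2 <=
      C ^+ 2 * (enorm (x - u) ^+ 2 + enorm (y - v) ^+ 2)].

Definition lip_part_set (Z2 S2 W1 : {fset 'rV[R]_d}) : set R :=
  [set C | 0 <= C /\ forall x y v, x \in W1 -> y \in Z2 -> v \in S2 ->
    `|kappa x y - kappa x v| ^+ 2 <= C ^+ 2 * enorm (y - v) ^+ 2].

(* L(Z, S) and L(Z2, S2)_{W1}.  The infima are minima: see [dlip_min] and
   [dlip_part_min]. *)
Definition dlip (Z S : {fset 'rV[R]_d * 'rV[R]_d}) : R := inf (lip_set Z S).

Definition dlip_part (Z2 S2 W1 : {fset 'rV[R]_d}) : R :=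
  inf (lip_part_set Z2 S2 W1).

Lemma inf_quadratic_min (T : eqType) (s : seq T) (a b : T -> R) :
    (forall t, 0 <= a t) -> (forall t, 0 <= b t) ->
    (forall t, b t = 0 -> a t = 0) ->
  let E := [set C | 0 <= C /\ forall t, t \in s -> a t <= C ^+ 2 * b t] in
  E (inf E) /\ lbound E (inf E).
Proof.
move=> a0 b0 ab E.
have E_lb : has_lbound E by exists 0 => C [].
have nE : E !=set0.
  have q0 t : 0 <= a t / b t by rewrite divr_ge0.
  have S0 : 0 <= \sum_(t <- s) a t / b t by rewrite sumr_ge0.
  exists (1 + \sum_(t <- s) a t / b t); split => [|t ts].
    by rewrite addr_ge0.
  have [bt0|bt0] := eqVneq (b t) 0; first by rewrite bt0 mulr0 ab.
  rewrite -ler_pdivrMr ?lt_def ?bt0 ?b0//.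
  have leS : a t / b t <= 1 + \sum_(t <- s) a t / b t.
    by rewrite (big_rem t ts)/= addrCA lerDl addr_ge0 ?sumr_ge0.
  by rewrite (le_trans leS)// expr2 ler_peMl ?addr_ge0// lerDl.
have lbE : lbound E (inf E) by move=> C EC; apply: ge_inf.
have i0 : 0 <= inf E by apply: lb_le_inf => // C [].
split=> //; split=> // t ts.
have [bt0|bt0] := eqVneq (b t) 0; first by rewrite bt0 mulr0 ab.
have bp : 0 < b t by rewrite lt_def bt0 b0.
rewrite -ler_pdivrMr// -(sqr_sqrtr (_ : 0 <= a t / b t)) ?divr_ge0//.
rewrite ler_pXn2r ?nnegrE ?sqrtr_ge0//.
apply: lb_le_inf => // C [C0 /(_ _ ts)].
rewrite -ler_pdivrMr// => h.
by rewrite -(ger0_norm C0) -sqrtr_sqr ler_wsqrtr.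
Qed.

Lemma enorm_eq0 (x : 'rV[R]_d) : enorm x ^+ 2 = 0 -> x = 0.
Proof.
rewrite sqr_sqrtr ?sumr_ge0// => [/eqP|i _]; last by rewrite sqr_ge0.
rewrite psumr_eq0 => [/allP h|i _]; last by rewrite sqr_ge0.
apply/rowP => i; rewrite mxE; apply/eqP; rewrite -sqrf_eq0.
exact: (h i (mem_index_enum _)).
Qed.

Lemma dlip_min (Z S : {fset 'rV[R]_d * 'rV[R]_d}) :
  lip_set Z S (dlip Z S) /\ lbound (lip_set Z S) (dlip Z S).
Proof.
pose s := [seq (p, q) | p <- enum_fset Z, q <- enum_fset S].
pose a t := `|kappa t.1.1 t.1.2 - kappa t.2.1 t.2.2| ^+ 2.
pose b (t : ('rV[R]_d * 'rV[R]_d) * ('rV[R]_d * 'rV[R]_d)) :=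
  enorm (t.1.1 - t.2.1) ^+ 2 + enorm (t.1.2 - t.2.2) ^+ 2.
suff sE : lip_set Z S =
    [set C | 0 <= C /\ forall t, t \in s -> a t <= C ^+ 2 * b t].
  rewrite /dlip sE; apply: inf_quadratic_min => [t|t|[[x y] [u v]]].
  - by rewrite exprn_ge0.
  - by rewrite addr_ge0 ?sqr_ge0.
  - move=> /eqP; rewrite paddr_eq0 ?sqr_ge0//= => /andP[/eqP h1 /eqP h2].
    move/enorm_eq0/subr0_eq : h1 => /= h1.
    move/enorm_eq0/subr0_eq : h2 => /= h2.
    by rewrite /a/= h1 h2 subrr normr0 expr0n.
apply/seteqP; split => C [C0 h]; split => //.
  by move=> _ /allpairsP[[[x y] [u v]] [/= pZ qS ->]]; exact: h.
move=> x y u v pZ qS; apply: (h ((x, y), (u, v))).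
by apply/allpairsP; exists ((x, y), (u, v)).
Qed.

Lemma dlip_part_min (Z2 S2 W1 : {fset 'rV[R]_d}) :
  lip_part_set Z2 S2 W1 (dlip_part Z2 S2 W1) /\
  lbound (lip_part_set Z2 S2 W1) (dlip_part Z2 S2 W1).
Proof.
pose s := [seq (x, q) | x <- enum_fset W1,

  q <- [seq (y, v) | y <- enum_fset Z2, v <- enum_fset S2]].
pose a t := `|kappa t.1 t.2.1 - kappa t.1 t.2.2| ^+ 2.
pose b (t : 'rV[R]_d * ('rV[R]_d * 'rV[R]_d)) := enorm (t.2.1 - t.2.2) ^+ 2.
suff sE : lip_part_set Z2 S2 W1 =
    [set C | 0 <= C /\ forall t, t \in s -> a t <= C ^+ 2 * b t].
  rewrite /dlip_part sE; apply: inf_quadratic_min => [t|t|[x [y v]]].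
  - by rewrite exprn_ge0.
  - by rewrite sqr_ge0.
  - by move=> /enorm_eq0/subr0_eq/= h; rewrite /a/= h subrr normr0 expr0n.
apply/seteqP; split => C [C0 h]; split => //.
  move=> _ /allpairsP[[x q] [/= xW /allpairsP[[y v] [/= yZ vS ->]] ->]].
  exact: h.
move=> x y v xW yZ vS; apply: (h (x, (y, v))).
apply/allpairsP; exists (x, (y, v)); split => //=.
by apply/allpairsP; exists (y, v).
Qed.

End Lipschitz.

(* Main.v *)
Require Import Defs.
From HB Require Import structures.
From mathcomp Require Import all_boot all_order all_algebra finmap.
From mathcomp Require Import all_classical all_reals all_analysis.

(** Write [U = interp_mx hIX P G] and let [p_k] be the points of [I].  For
[x] in [X], [y] in [Y] and any [s] in [S], the decomposition is exact on the
columns of [S], so that [kappa x s] is the combination of the [kappa p_k s]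
with coefficients [U x k].  Subtracting this identity from the error entry gives
[[
  kappa x y - \sum_k U x k * kappa p_k y
    = (kappa x y - kappa x s) - \sum_k U x k * (kappa p_k y - kappa p_k s),
]]
in which the kernel only varies in its second argument.  Since the rows of [U]
are rows of [1; G] in another order, its entries are at most 2 in absolute value
([interp_mx_entry_le]), and the error is at most the variation of the kernel over
[X] plus [2 * r] times its variation over [I] ([interp_error_le]).

Taking for [s] a point of [S] nearest to [y], at a distance at most
[fill_dist Y S], each variation is a Lipschitz constant times the fill distance
([dlip_slice], [kernel_lipschitz_slice]).  This yields the first and the last
term of the bounds; the term in [Num.sqrt m] is nonnegative. *)

Set Implicit Arguments.
Unset Strict Implicit.
Unset Printing Implicit Defensive.

Import Order.TTheory GRing.Theory Num.Theory.

Local Open Scope classical_set_scope.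
Local Open Scope ring_scope.

Lemma mx_norm_le (R : realType) (m n : nat) (A : 'M[R]_(m, n)) (e : R) :
  0 <= e -> (forall i j, `|A i j| <= e) -> mx_norm A <= e.
Proof. by move=> e0 h; rewrite mx_normrE; apply: bigmax_le => // -[i j] _. Qed.

Lemma entry_le_mx_norm (R : realType) (m n : nat) (A : 'M[R]_(m, n)) i j :
  `|A i j| <= mx_norm A.
Proof.
by rewrite mx_normrE (le_bigmax _ (fun ij => `|A ij.1 ij.2|) (i, j)).
Qed.

Lemma enorm0 (R : realType) (d : nat) : enorm (0 : 'rV[R]_d) = 0.
Proof. by rewrite /enorm big1 ?sqrtr0// => i _; rewrite mxE expr0n. Qed.

Lemma enorm_ge0 (R : realType) (d : nat) (x : 'rV[R]_d) : 0 <= enorm x.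
Proof. exact: sqrtr_ge0. Qed.

Lemma fill_dist_ge0 (R : realType) (d : nat) (Z S : {fset 'rV[R]_d}) :
  0 <= fill_dist Z S.
Proof. exact: bigmax_ge_id. Qed.

Lemma fill_dist_nearest (R : realType) (d : nat) (Z S : {fset 'rV[R]_d}) z :
    S != fset0 -> z \in Z ->
  exists2 s, s \in S & enorm (z - s) <= fill_dist Z S.
Proof.
move=> S0 zZ; have [s sS ds] := dist_to_attained z S0.
by exists s => //; rewrite -ds; apply: le_fill_dist.
Qed.

Lemma pt_in (R : realType) (d : nat) (A : {fset 'rV[R]_d}) (i : 'I_#|` A|) :
  pt i \in A.
Proof. exact: mem_tnth. Qed.

Lemma pt_onto (R : realType) (d : nat) (A : {fset 'rV[R]_d}) x :
  x \in A -> exists i : 'I_#|` A|, pt i = x.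
Proof. by move=> /(tnthP (in_tuple A))[i ->]; exists i. Qed.

(** A permutation only moves rows, so every entry of the interpolation matrix is
0 or 1 or an entry of [G]. *)
Lemma interp_mx_entry_le (R : realType) (d : nat) (X I : {fset 'rV[R]_d})
    (hIX : (I `<=` X)%fset) (P : 'M[R]_#|` X|)
    (G : 'M[R]_(#|` X| - #|` I|, #|` I|)) (c : R) i k :
    is_perm_mx P -> 1 <= c -> mx_norm G <= c ->
  `|interp_mx hIX P G i k| <= c.
Proof.
move=> /is_perm_mxP[s ->] c1 hG.
rewrite /interp_mx -row_permE mxE castmxE mxE.
case: fintype.split => j; last exact: le_trans (entry_le_mx_norm _ _ _) hG.
by rewrite mxE; case: eqP => _; rewrite ?normr1 ?normr0// (le_trans ler01).
Qed.

(** If [K_XS = U K_IS] holds exactly, the error of [U K_IY] in the column of [y]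
is the error of the increments from the column of some [s] in [S] to that of
[y].  The same [s] has to serve all the rows, those of [X] and those of [I]. *)
Lemma interp_error_le (R : realType) (d : nat) (X Y S I : {fset 'rV[R]_d})
    (kappa : 'rV[R]_d -> 'rV[R]_d -> R) (U : 'M[R]_(#|` X|, #|` I|))
    (c eX eI : R) :
    kmx kappa X S = U *m kmx kappa I S ->
    0 <= c -> 0 <= eX -> 0 <= eI -> (forall i k, `|U i k| <= c) ->
    (forall y, y \in Y -> exists2 s, s \in S &
       {in X, forall x, `|kappa x y - kappa x s| <= eX} /\
       {in I, forall x, `|kappa x y - kappa x s| <= eI}) ->
  mx_norm (kmx kappa X Y - U *m kmx kappa I Y) <= eX + c * #|` I|%:R * eI.
Proof.
move=> hK c0 eX0 eI0 hU near.
apply: mx_norm_le => [|i j]; first by rewrite addr_ge0 ?mulr_ge0.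
have [_ /pt_onto[l <-] [hX hI]] := near _ (pt_in j).
have hKil : kappa (pt i) (pt l) = \sum_k U i k * kappa (pt k) (pt l).
  move/matrixP: hK => /(_ i l); rewrite !mxE => ->.
  by apply: eq_bigr => k _; rewrite mxE.
have -> : (kmx kappa X Y - U *m kmx kappa I Y) i j =
    (kappa (pt i) (pt j) - kappa (pt i) (pt l)) -
    \sum_k U i k * (kappa (pt k) (pt j) - kappa (pt k) (pt l)).
  rewrite !mxE; under [X in _ = _ - X]eq_bigr do rewrite mulrBr.
  rewrite sumrB -hKil opprB addrA subrK.
  by congr (_ - _); apply: eq_bigr => k _; rewrite mxE.
rewrite (le_trans (ler_normB _ _))// lerD ?hX ?pt_in//.
rewrite (le_trans (ler_norm_sum _ _ _))//.
have -> : c * #|` I|%:R * eI = \sum_(k < #|` I|) c * eI.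
  by rewrite sumr_const card_ord -[RHS]mulr_natr mulrAC.
by apply: ler_sum => k _; rewrite normrM ler_pM ?hU ?hI ?pt_in.
Qed.

Lemma dlip_ge0 (R : realType) (d : nat)
    (kappa : 'rV[R]_d -> 'rV[R]_d -> R) (Z S : {fset 'rV[R]_d * 'rV[R]_d}) :
  0 <= dlip kappa Z S.
Proof. by have [[]] := dlip_min kappa Z S. Qed.

Lemma dlip_part_ge0 (R : realType) (d : nat)
    (kappa : 'rV[R]_d -> 'rV[R]_d -> R) (Z2 S2 W1 : {fset 'rV[R]_d}) :
  0 <= dlip_part kappa Z2 S2 W1.
Proof. by have [[]] := dlip_part_min kappa Z2 S2 W1. Qed.

(** Equal first arguments reduce the joint Lipschitz condition to one in the
second argument. *)
Lemma dlip_slice (R : realType) (d : nat)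
    (kappa : 'rV[R]_d -> 'rV[R]_d -> R) (A Y S : {fset 'rV[R]_d}) x y s :
    x \in A -> y \in Y -> s \in S ->
  `|kappa x y - kappa x s| <=
    dlip kappa (A `*` Y)%fset (A `*` S)%fset * enorm (y - s).
Proof.
move=> xA yY sS; have [[L0 h] _] := dlip_min kappa (A `*` Y)%fset (A `*` S)%fset.
have := h x y x s; rewrite !in_fsetM/= xA yY sS => /(_ isT isT).
rewrite subrr enorm0 expr0n add0r -exprMn.
by rewrite ler_pXn2r// nnegrE ?mulr_ge0 ?enorm_ge0 ?normr_ge0.
Qed.

Lemma kernel_lipschitz_slice (R : realType) (d : nat)
    (kappa : 'rV[R]_d -> 'rV[R]_d -> R) (D1 D2 : set 'rV[R]_d) (L : R) x y s :
    kernel_lipschitz kappa D1 D2 L -> D1 x -> D2 y -> D2 s ->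
  `|kappa x y - kappa x s| <= L * enorm (y - s).
Proof.
move=> hL xD yD sD; have := hL x y x s xD yD xD sD.
by rewrite subrr enorm0 expr0n add0r sqrtr_sqr (ger0_norm (enorm_ge0 _)).
Qed.

(** A Lipschitz constant may be negative when the domain has at most one point;
its product with the fill distance never is, since the fill distance is the
distance between two points of [D2]. *)
Lemma kernel_lipschitz_fill_dist_ge0 (R : realType) (d : nat)
    (kappa : 'rV[R]_d -> 'rV[R]_d -> R) (D1 D2 : set 'rV[R]_d) (L : R)
    (Y S : {fset 'rV[R]_d}) x :
    kernel_lipschitz kappa D1 D2 L -> D1 x -> {in Y, forall y, D2 y} ->
    (S `<=` Y)%fset -> Y != fset0 -> S != fset0 ->
  0 <= L * fill_dist Y S.
Proof.
move=> hL xD YD /fsubsetP SY Y0 S0.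
have [y yY ->] := fill_dist_attained S Y0.
have [s sS ->] := dist_to_attained y S0.
have := kernel_lipschitz_slice hL xD (YD _ yY) (YD _ (SY _ sS)).
exact: le_trans.
Qed.

(** If [L] is negative, a nonnegative [L * t] is 0, so the larger value of [t]
still gives the larger product. *)
Lemma ler_wM2l_prod_ge0 (R : realType) (L s t : R) :
  0 <= s -> 0 <= L * t -> s <= t -> L * s <= L * t.
Proof.
move=> s0 Lt st; have [L0|L0] := leP 0 L; first exact: ler_wpM2l.
by rewrite (le_trans _ Lt)// nmulr_rle0.
Qed.

Theorem theorem3p3 (R : realType) (d : nat) (X Y : {fset 'rV[R]_d})
    (kappa : 'rV[R]_d -> 'rV[R]_d -> R) (S I : {fset 'rV[R]_d})
    (P : 'M[R]_#|` X|) (G : 'M[R]_(#|` X| - #|` I|, #|` I|))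
    (hX : X != fset0) (hY : Y != fset0)
    (hSY : (S `<=` Y)%fset) (hS : S != fset0)
    (hIX : (I `<=` X)%fset) (hI : I != fset0)
    (hP : row_placement hIX P)
    (hK : kmx kappa X S = interp_mx hIX P G *m kmx kappa I S)
    (hG : mx_norm G <= 2) :
  let m : R := #|` X|%:R in
  let r : R := #|` I|%:R in
  let err := mx_norm (kmx kappa X Y - interp_mx hIX P G *m kmx kappa I Y) in
  err <= dlip kappa (X `*` Y)%fset (X `*` S)%fset * fill_dist Y S
         + (1 + 2 * r) * Num.sqrt m * dlip_part kappa Y S X * fill_dist Y S
         + 2 * r * dlip kappa (I `*` Y)%fset (I `*` S)%fset * fill_dist Y S
  /\
  (forall (D1 D2 : set 'rV[R]_d) (L : R),
     [set` X] `*` [set` Y] `<=` D1 `*` D2 ->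
     kernel_lipschitz kappa D1 D2 L ->
     err <= L * fill_dist Y S
            + (1 + 2 * r) * Num.sqrt m * L * fill_dist Y S
            + 2 * r * L * fill_dist Y S).
Proof.
move=> m r err.
have U2 i k : `|interp_mx hIX P G i k| <= 2.
  by apply: interp_mx_entry_le => //; [case: hP | rewrite ler1n].
have delta0 := fill_dist_ge0 Y S.
have c0 : 0 <= (1 + 2 * r) * Num.sqrt m.
  by rewrite mulr_ge0 ?sqrtr_ge0// addr_ge0// mulr_ge0.
split=> [|D1 D2 L sub hL].
- set LX := dlip _ _ _; set LI := dlip _ (I `*` Y)%fset _.
  have LX0 : 0 <= LX by exact: dlip_ge0.
  have LI0 : 0 <= LI by exact: dlip_ge0.
  have le_err : err <= LX * fill_dist Y S + 2 * r * (LI * fill_dist Y S).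
    apply: (interp_error_le hK) => //; rewrite ?mulr_ge0// => y yY.
    have [s sS hs] := fill_dist_nearest hS yY.
    exists s => //; split=> x xA; apply: le_trans (dlip_slice _ xA yY sS) _.
      exact: ler_wpM2l.
    exact: ler_wpM2l.
  rewrite (le_trans le_err)// mulrA lerD2r lerDl.
  exact/mulr_ge0/delta0/mulr_ge0/dlip_part_ge0.
- have [[x0 x0X] [y0 y0Y]] := (fset0Pn _ hX, fset0Pn _ hY).
  have XD : {in X, forall x, D1 x}.
    by move=> x xX; have [] := sub (x, y0) (conj xX y0Y).
  have YD : {in Y, forall y, D2 y}.
    by move=> y yY; have [] := sub (x0, y) (conj x0X yY).
  have Ld0 : 0 <= L * fill_dist Y S.
    exact: (kernel_lipschitz_fill_dist_ge0 hL (XD _ x0X)).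
  have le_err : err <= L * fill_dist Y S + 2 * r * (L * fill_dist Y S).
    apply: (interp_error_le hK) => // y yY.
    have [s sS hs] := fill_dist_nearest hS yY.
    have near : {in X, forall x,
        `|kappa x y - kappa x s| <= L * fill_dist Y S}.
      move=> x xX; have sD := YD _ (fsubsetP hSY _ sS).
      apply: le_trans (kernel_lipschitz_slice hL (XD _ xX) (YD _ yY) sD) _.
      by apply: ler_wM2l_prod_ge0 => //; apply: enorm_ge0.
    by exists s => //; split=> // x /(fsubsetP hIX)/near.
  by rewrite (le_trans le_err)// mulrA lerD2r lerDl -mulrA mulr_ge0.
Qed.
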